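(* Let $d$ be a positive integer. There is a constant $s=s(d)$ such that for every positive integer $n$ there exist a finite field $\mathbb{F}_q$ and a set $\mathcal{P}$ of $n$ points in $\mathbb{F}_q^d$ such that the unit distance graph of $\mathcal{P}$ contains no copy of $K_{s,s}$ and $\mathcal{P}$ spans at least $c\, n^{2-\frac{1}{\lceil d/2\rceil+1}}$ unit distances, where $c>0$ depends only on $d$.
   Context: The unit sphere in $\mathbb{F}_q^d$ with center $a$ is the set of $x\in\mathbb{F}_q^d$ with $(x_1-a_1)^2+\dots+(x_d-a_d)^2=1$. Points $a,b$ are at unit distance if $b$ lies on the unit sphere with center $a$. The unit distance graph of $\mathcal{P}$ has vertex set $\mathcal{P}$ with edges between pairs at unit distance; the number of unit distances spanned is the number of such pairs.
   Formalization: The formal theorem assumes d ≥ 2 and n ≥ 2: for d = 1, n points span at most n unit distances, so the bound c·n^{3/2} fails for large n, and for n = 1 a single point spans no unit distance while c > 0. *)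

(* Defs.v *)
From HB Require Import structures.
From mathcomp Require Import all_boot all_order all_algebra.

Set Implicit Arguments.
Unset Strict Implicit.
Unset Printing Implicit Defensive.

Import GRing.Theory.
Local Open Scope ring_scope.

Section UnitDistance.
Variables (F : finFieldType) (d : nat).

Definition unit_sphere (a : 'rV[F]_d) : {set 'rV[F]_d} :=
  [set x : 'rV[F]_d | \sum_(i < d) (x 0 i - a 0 i) ^+ 2 == 1].

Definition at_unit_distance (a b : 'rV[F]_d) : bool := b \in unit_sphere a.

(* Edge set, as unordered pairs. These are genuine two-element sets, because a
   point is at distance 0 <> 1 from itself; hence the cardinal of this set is
   the number of unit distances spanned by P. *)
Definition unit_distance_edges (P : {set 'rV[F]_d}) : {set {set 'rV[F]_d}} :=
  [set [set a; b] | a in P, b in P & at_unit_distance a b].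

End UnitDistance.

(* The graph with vertex set V and edge set E contains K_{s,t} as a (not
   necessarily induced) subgraph. *)
Definition contains_complete_bipartite (T : finType) (V : {set T})
    (E : {set {set T}}) (s t : nat) : Prop :=
  exists A B : {set T},
    [/\ A \subset V, B \subset V, [disjoint A & B], #|A| = s & #|B| = t] /\
    (forall a b : T, a \in A -> b \in B -> [set a; b] \in E).

(* Main.v *)
(** Let [q = 9 ^ e], [m = d./2 - 1] and [D = d - m = uphalf d + 1].  In [K ^ d] with
    [K = F_q], take two fibers of the additive map
    [v |-> (\sum_j al_j ^ i * v_j ^ (3 ^ (d - j)))_(i < m)] with distinct [al_j]; a fiber
    has at least [q ^ D] points, and for a suitable choice of the second fiber a
    proportion of order [1/q] of the pairs is at distance 1 for a diagonal quadratic form.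
    This form becomes a sum of squares over an extension of [K], so the points can be
    moved to [F ^ d]; deleting vertices of small degree leaves exactly [n] points.

    If all distances between [A] and [B] are 1, the affine spans of [A] and [B] have
    orthogonal directions, so one of them, say that of [B], has dimension at most
    [m + 1].  Give [v_j] the weight [3 ^ j], and call it a pivot if on [B] it is not an
    affine combination of the [v_l] with [l < j]; other coordinates reduce to lower
    weight.  Modulo lower weight the [m] equations of a fiber kill the leading powers
    [v_j ^ (3 ^ (d - j))] of the pivots if there are at most [m] pivots, and make them
    proportional to each other if there are [m + 1].  In the latter case the sphere gives
    one more relation.  Its leading monomial is unique since a sum of two powers of 3
    determines the powers, and it is not trivial: otherwise the form minus a square would
    have a totally isotropic subspace of dimension [m + 2], which exceeds half of [d + 1]
    for even [d] and is excluded by the discriminant for odd [d].  Hence every coordinate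
    has a bounded power that reduces to lower weight, so boundedly many monomials span all
    functions on [B], and [#|B|] is bounded. *)

Require Import Defs.
From HB Require Import structures.
From mathcomp Require Import all_boot all_order all_algebra all_field.
From mathcomp Require Import zify ring.
From mathcomp Require Import reals exp.

Set Implicit Arguments.
Unset Strict Implicit.
Unset Printing Implicit Defensive.

Import Order.TTheory GRing.Theory Num.Theory.
Local Open Scope ring_scope.

(** * Functions on a finite point set, filtered by weighted degree *)

Section WeightedSpan.
Variables (K : fieldType) (I T : finType) (w : I -> nat) (x : I -> T -> K).

Definition weight (e : I -> nat) : nat := (\sum_i w i * e i)%N.
Definition monomial (e : I -> nat) (z : T) : K := \prod_i x i z ^+ e i.

(** Functions are compared pointwise, so closure under [=1] is a constructor. *)
Inductive span (S : (I -> nat) -> Prop) : (T -> K) -> Prop :=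
| span_ext f g of f =1 g & span S f : span S g
| span0 : span S (fun=> 0)
| span_cons c e f of S e & span S f : span S (fun z => c * monomial e z + f z).

(** Some representing polynomial has to have small weight, so relations that hold on the points can
    lower the weight. Only the zero function is in [low 0]. *)
Definition low (n : nat) : (T -> K) -> Prop := span (fun e => (weight e < n)%N).

Lemma spanW (S S' : (I -> nat) -> Prop) f :
  (forall e, S e -> span S' (monomial e)) -> span S f -> span S' f.
Proof.
move=> SS'; elim=> {f} [f g fg _ | | c e f /SS' Se _ IH].
- exact: span_ext.
- exact: span0.
elim: Se f IH => [h g hg _ IHh f Sf | f Sf | c' e' h Se' Sh IHh f Sf].
- by apply: span_ext (IHh f Sf) => z; rewrite hg.
- by apply: span_ext Sf => z; rewrite mulr0 add0r.
apply: span_ext (span_cons (c * c') Se' (IHh f Sf)) => z; ring.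
Qed.

Lemma spanD S f g : span S f -> span S g -> span S (fun z => f z + g z).
Proof.
move=> Sf Sg; elim: Sf => {f} [f h fh _ | | c e f Se _ IH].
- by apply: span_ext => z; rewrite fh.
- by apply: span_ext Sg => z; rewrite add0r.
by apply: span_ext (span_cons c Se IH) => z; rewrite addrA.
Qed.

Lemma spanZ S c f : span S f -> span S (fun z => c * f z).
Proof.
elim=> {f} [f h fh _ | | c' e f Se _ IH].
- by apply: span_ext => z; rewrite fh.
- by apply: span_ext (span0 S) => z; rewrite mulr0.
by apply: span_ext (span_cons (c * c') Se IH) => z; rewrite mulrDr mulrA.
Qed.

Lemma span_monomial (S : (I -> nat) -> Prop) e : S e -> span S (monomial e).
Proof.
by move=> Se; apply: span_ext (span_cons 1 Se (span0 S)) => z; rewrite mul1r addr0.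
Qed.

Lemma span_sum S (J : finType) (A : pred J) (F : J -> T -> K) :
  (forall j, A j -> span S (F j)) -> span S (fun z => \sum_(j | A j) F j z).
Proof.
move=> SF; suff: forall s, span S (fun z => \sum_(j <- s | A j) F j z) by [].
elim=> [|j s IH]; first by apply: span_ext (span0 S) => z; rewrite big_nil.
case Aj: (A j); last by apply: span_ext IH => z; rewrite big_cons Aj.
by apply: span_ext (spanD (SF j Aj) IH) => z; rewrite big_cons Aj.
Qed.

Lemma low_leq n n' f : (n <= n')%N -> low n f -> low n' f.
Proof. by move=> le_nn'; apply: spanW => e /leq_trans/(_ le_nn'); exact: span_monomial. Qed.

Lemma low0 f : low 0 f -> forall z, f z = 0.
Proof. by elim=> // [g h gh _ IH] z; rewrite -gh. Qed.

Lemma monomialM e e' z :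
  monomial e z * monomial e' z = monomial (fun i => e i + e' i)%N z.
Proof. by rewrite -big_split; apply: eq_bigr => i _; rewrite exprD. Qed.

Lemma weightD e e' : weight (fun i => e i + e' i)%N = (weight e + weight e')%N.
Proof. by rewrite -big_split; apply: eq_bigr => i _; rewrite mulnDr. Qed.

(* Both bounds are strict, so the weight bound on the product improves by one. *)
Lemma lowM m n f g :
  low m.+1 f -> low n.+1 g -> low (m + n).+1 (fun z => f z * g z).
Proof.
move=> Lf Lg; elim: Lf => {f} [f h fh _ | | c e f le_e _ IH].
- by apply: span_ext => z; rewrite fh.
- by apply: span_ext (span0 _) => z; rewrite mul0r.
suff Lcg: low (m + n).+1 (fun z => c * monomial e z * g z).
  by apply: span_ext (spanD Lcg IH) => z; rewrite mulrDl.
elim: Lg => {g IH} [g h gh _ | | c' e' g le_e' _ IH].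
- by apply: span_ext => z; rewrite gh.
- by apply: span_ext (span0 _) => z; rewrite mulr0.
have We: (weight (fun i => e i + e' i) < (m + n).+1)%N by rewrite weightD ltnS leq_add.
apply: span_ext (span_cons (c * c') We IH) => z.
by rewrite -monomialM; ring.
Qed.

Lemma lowM_lt m n f g :
  low m.+1 f -> low n g -> low (m + n) (fun z => f z * g z).
Proof.
case: n => [_ /low0 g0|n Lf Lg]; last by rewrite addnS; exact: lowM.
by apply: span_ext (span0 _) => z; rewrite g0 mulr0.
Qed.

Lemma low_const n c : low n.+1 (fun=> c).
Proof.
have e0: (weight (fun=> 0) < n.+1)%N by rewrite /weight big1 // => i; rewrite muln0.
apply: span_ext (span_cons c e0 (span0 _)) => z.
by rewrite /monomial big1 ?mulr1 ?addr0.
Qed.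

Lemma low_exp m n f : low m.+1 f -> low (m * n).+1 (fun z => f z ^+ n).
Proof.
move=> Lf; elim: n => [|n IH].
  by rewrite muln0; apply: span_ext (low_const 0 1) => z; rewrite expr0.
by rewrite mulnS; apply: span_ext (lowM Lf IH) => z; rewrite exprS.
Qed.

Lemma low_exp_lt m n f : (0 < n)%N -> low m f -> low (m * n) (fun z => f z ^+ n).
Proof.
case: n => // n _ Lf; case: m Lf => [/low0 f0|m Lf].
  by apply: span_ext (span0 _) => z; rewrite f0 expr0n.
apply: low_leq (low_exp n.+1 Lf); lia.
Qed.

(** Telescoping: [f^(n+1) - g^(n+1) = f^n (f - g) + g (f^n - g^n)]. *)
Lemma low_congr_exp m n f g :
  low m.+1 f -> low m.+1 g -> low m (fun z => f z - g z) ->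
  low (m * n) (fun z => f z ^+ n - g z ^+ n).
Proof.
move=> Lf Lg Lfg; elim: n => [|n IH].
  by rewrite muln0; apply: span_ext (span0 _) => z; rewrite !expr0 subrr.
have L1 := lowM_lt (low_exp n Lf) Lfg; have L2 := lowM_lt Lg IH.
rewrite mulnS; rewrite addnC in L1.
by apply: span_ext (spanD L1 L2) => z; rewrite !exprS; ring.
Qed.

Lemma low_var i : low (w i).+1 (x i).
Proof.
have Wi: (weight (fun j => i == j) < (w i).+1)%N.
  rewrite /weight (bigD1 i) //= eqxx muln1 big1 ?addn0 // => j /negPf.
  by rewrite eq_sym => ->; rewrite muln0.
apply: span_ext (span_monomial Wi) => z.
rewrite /monomial (bigD1 i) //= eqxx expr1 big1 ?mulr1 // => j /negPf.
by rewrite eq_sym => ->.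
Qed.

Lemma low_expW i n m : (n <= m)%N ->
  low (w i * n) (fun z => x i z ^+ n) -> low (w i * m) (fun z => x i z ^+ m).
Proof.
move=> le_nm /(lowM_lt (low_exp (m - n) (low_var i))).
rewrite -mulnDr subnK //; apply: span_ext => z.
by rewrite -exprD subnK.
Qed.

(* Reduction to bounded exponents terminates because each reduction strictly
   decreases the weight. *)
Lemma low_bounded N n f :
    (forall i, low (w i * N) (fun z => x i z ^+ N)) ->
  low n f -> span (fun e => forall i, (e i < N)%N) f.
Proof.
move=> red; elim/ltn_ind: n f => n IHn f.
apply: spanW => e lt_en.
have [/forallP/= small | ] := boolP [forall i, e i < N]%N.
  exact: span_monomial.
rewrite negb_forall => /existsP[i]; rewrite -leqNgt => le_N.
pose h j := if j == i then N else 0%N; pose e' j := (e j - h j)%N.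
have ee' j : e j = (e' j + h j)%N by rewrite subnK // /h; case: eqP => // ->.
have We: weight e = (weight e' + w i * N)%N.
  transitivity (weight (fun j => e' j + h j)%N); first by apply: eq_bigr => j _; rewrite -ee'.
  rewrite weightD; congr addn; rewrite /weight (bigD1 i) //= /h eqxx.
  by rewrite big1 ?addn0 // => j /negPf->; rewrite muln0.
have Le': low (weight e').+1 (monomial e') by apply: span_monomial.
have := lowM_lt Le' (red i); rewrite -We => /(IHn _ lt_en); apply: span_ext => z.
transitivity (monomial e' z * monomial h z).
  congr (_ * _); rewrite /monomial (bigD1 i) //= /h eqxx.
  by rewrite big1 ?mulr1 // => j /negPf->.
by rewrite monomialM; apply: eq_bigr => j _; rewrite ee'.
Qed.

(** Lagrange interpolation: for each [z'] other than [z0], an affine factor in a coordinate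
    separating them is 1 at [z0] and 0 at [z']. *)
Lemma low_indicator z0 : (forall z z', (forall i, x i z = x i z') -> z = z') ->
  exists n, low n (fun z => (z == z0)%:R).
Proof.
move=> sep; suff [n] : exists n, low n.+1 (fun z => \prod_(z' in predC1 z0)
    (if [pick i | x i z0 != x i z'] is Some i
     then (x i z0 - x i z')^-1 * (x i z - x i z') else 1)).
  move=> L; exists n.+1; apply: span_ext L => z.
  have [->|ne_z] := eqVneq z z0.
    rewrite big1 // => z' _; case: pickP => // i ne_i.
    by rewrite mulVf // subr_eq0.
  rewrite (bigD1 z) //=; case: pickP => [i _|eqx]; first by rewrite subrr mulr0 mul0r.
  case/eqP: ne_z; apply: sep => i; apply/eqP.
  by have := eqx i; rewrite eq_sym => /negbFE.
suff: forall (s : seq T) (A : pred T), exists n, low n.+1 (fun z => \prod_(z' <- s | A z')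
    (if [pick i | x i z0 != x i z'] is Some i
     then (x i z0 - x i z')^-1 * (x i z - x i z') else 1)) by apply.
move=> s A; elim: s => [|z' s [n IH]].
  by exists 0%N; apply: span_ext (low_const 0 1) => z; rewrite big_nil.
case Az': (A z'); last by exists n; apply: span_ext IH => z; rewrite big_cons Az'.
case E: [pick i | x i z0 != x i z'] => [i|]; last first.
  by exists n; apply: span_ext IH => z; rewrite big_cons Az' E mul1r.
have Li := spanZ (x i z0 - x i z')^-1 (spanD (low_var i) (low_const (w i) (- x i z'))).
exists (w i + n)%N; apply: span_ext (lowM Li IH) => z.
by rewrite big_cons Az' E.
Qed.

(** The [N ^ #|I|] monomials with exponents below [N] span all indicators of points, hence a space
    of dimension [#|T|]. *)
Lemma card_le_of_low N :
    (forall z z', (forall i, x i z = x i z') -> z = z') ->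
    (forall i, low (w i * N) (fun z => x i z ^+ N)) ->
  (#|T| <= N ^ #|I|)%N.
Proof.
move=> sep red.
pose M : 'M[K]_(#|{: {ffun I -> 'I_N}}|, #|T|) :=
  \matrix_(k, j) monomial (fun i => (enum_val k : {ffun I -> 'I_N}) i : nat) (enum_val j).
have subM f : span (fun e => forall i, (e i < N)%N) f ->
    ((\row_j f (enum_val j) : 'rV[K]_#|T|) <= M)%MS.
  elim=> {f} [f g fg _ IH | | c e f small _ IH].
  - by rewrite -(_ : \row_j f (enum_val j) = \row_j g (enum_val j)) //;
      apply/rowP=> j; rewrite !mxE fg.
  - by rewrite (_ : \row_j _ = 0) ?sub0mx //; apply/rowP=> j; rewrite !mxE.
  pose k := enum_rank [ffun i => Ordinal (small i)].
  rewrite (_ : \row_j _ = c *: row k M + \row_j f (enum_val j)); last first.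
    apply/rowP=> j; rewrite !mxE; congr (_ * _ + _); apply: eq_bigr => i _.
    by rewrite enum_rankK ffunE.
  by rewrite addmx_sub // scalemx_sub // row_sub.
have: (1%:M <= M)%MS.
  apply/row_subP=> j; have [n L] := low_indicator (enum_val j) sep.
  have := subM _ (low_bounded red L); rewrite (_ : \row_i _ = row j 1%:M) //.
  by apply/rowP=> i; rewrite !mxE (inj_eq enum_val_inj) eq_sym.
move/mxrankS; rewrite mxrank1 => /leq_trans; apply.
by rewrite (leq_trans (rank_leq_row M)) // card_ffun card_ord.
Qed.

End WeightedSpan.

(** * Pivot rows of a matrix *)

Section Pivots.
Variables (K : fieldType) (n N : nat) (Y : 'M[K]_(n, N)).

Let before (A : pred 'I_n) (t : nat) : 'M[K]_(n, N) :=
  \matrix_(l < n) if (l < t)%N && A l then row l Y else 0.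

Lemma before_sub (A : pred 'I_n) t (l : 'I_n) :
  (l < t)%N -> A l -> (row l Y <= before A t)%MS.
Proof.
move=> lt_l Al; apply: submx_trans (row_sub l (before A t)).
by rewrite rowK lt_l Al.
Qed.

Lemma before_leq (A : pred 'I_n) t t' :
  (t <= t')%N -> (before A t <= before A t')%MS.
Proof.
move=> le_t; apply/row_subP=> l; rewrite rowK; case: ifP => [/andP[lt_l Al]|_].
  exact: before_sub (leq_trans lt_l le_t) Al.
exact: sub0mx.
Qed.

(* Row [u] is a pivot when it is independent of the preceding rows. *)
Lemma echelon_pivots : exists (J : {set 'I_n}) (C : 'M[K]_n),
  [/\ (#|J| <= \rank Y)%N, Y = C *m Y,
      forall u l, C u l != 0 -> (l \in J) && (l <= u)%N,
      forall u l, u \notin J -> C u l != 0 -> (l < u)%N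
    & forall u, row u Y != 0 -> (forall l : 'I_n, (u <= l)%N) -> u \in J].
Proof.
have [J inJ] : exists J : {set 'I_n},
    forall u, (u \in J) = ~~ (row u Y <= before predT u)%MS.
  by exists [set u : 'I_n | ~~ (row u Y <= before predT u)%MS] => u; rewrite inE.
have spanJ t : (before predT t <= before (mem J) t)%MS.
  elim: t => [|t IH]; apply/row_subP=> l; rewrite rowK; first exact: sub0mx.
  case: ifP => [/andP[]|_]; last exact: sub0mx.
  rewrite ltnS leq_eqVlt => /predU1P[lt _|lt_l _]; last first.
    apply: submx_trans (before_leq (mem J) (leqnSn t)).
    exact: submx_trans (before_sub lt_l _) IH.
  have [lJ|] := boolP (l \in J); first by apply: before_sub; rewrite ?lt.
  rewrite inJ negbK lt => /submx_trans; apply.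
  exact: submx_trans IH (before_leq _ _).
(* Each pivot strictly enlarges the span of the preceding rows. *)
have rankJ t : (#|[set u in J | (u < t)%N]| <= \rank (before predT t))%N.
  elim: t => [|t IH]; first by rewrite (_ : [set _ in _ | _] = set0) ?cards0 //;
    apply/setP=> u; rewrite !inE andbF.
  have [u_ex|no_u] := boolP [exists u : 'I_n, (u == t :> nat) && (u \in J)]; last first.
    rewrite (_ : [set _ in _ | _] = [set u in J | (u < t)%N]); last first.
      apply/setP=> u; rewrite !inE ltnS leq_eqVlt.
      case: eqP => //= ut; rewrite ut ltnn andbT andbF.
      by apply: contraNF no_u => uJ; apply/existsP; exists u; rewrite ut eqxx.
    by rewrite (leq_trans IH) // mxrankS // before_leq.
  case/existsP: u_ex => u /andP[/eqP ut uJ].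
  rewrite (_ : [set _ in _ | _] = u |: [set u in J | (u < t)%N]); last first.
    apply/setP=> v; rewrite !inE ltnS leq_eqVlt -ut.
    by have [->|] := eqVneq v u; rewrite ?uJ ?eqxx // -val_eqE => /negPf->.
  rewrite cardsU1 !inE -ut ltnn andbF /= add1n ut.
  apply: leq_ltn_trans IH _; apply: rank_ltmx.
  rewrite ltmxE before_leq //=; move: uJ; rewrite inJ; apply: contra => sub.
  rewrite ut; apply: submx_trans sub; apply: before_sub => //.
  by rewrite ut.
have beforeT : (before predT n <= Y)%MS.
  by apply/row_subP=> l; rewrite rowK ltn_ord /= row_sub.
have comb u : exists c : 'rV[K]_n, row u Y = c *m Y /\
   (forall l, c 0 l != 0 -> [&& l \in J, (l <= u)%N & (u \notin J) ==> (l < u)%N]).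
  have [uJ|nuJ] := boolP (u \in J).
    exists (delta_mx 0 u); split; first exact: rowE.
    move=> l; rewrite mxE eqxx /=; case: (eqVneq l u) => [->|]; last by rewrite eqxx.
    by rewrite uJ leqnn.
  have /submxP[c def_c]: (row u Y <= before (mem J) u)%MS.
    by move: nuJ; rewrite inJ negbK => /submx_trans; apply; exact: spanJ.
  (* Erasing the coefficients on the zero rows of [before] keeps the product and confines the
     support to earlier pivots. *)
  exists (\row_l if (l < u)%N && (l \in J) then c 0 l else 0); split.
    rewrite def_c; apply/rowP=> z; rewrite !mxE; apply: eq_bigr => l _; rewrite !mxE.
    by case: ifP => _; rewrite ?mxE ?mul0r ?mulr0.
  move=> l; rewrite !mxE; case: ifP => [/andP[lt_l lJ] _|]; last by rewrite eqxx.
  by rewrite lJ lt_l ltnW.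
have /fin_all_exists[c hc] := comb.
exists J, (\matrix_u c u); split.
- apply: leq_trans (mxrankS beforeT); apply: leq_trans (rankJ n); apply: subset_leq_card.
  by apply/subsetP=> u uJ; rewrite inE uJ ltn_ord.
- by apply/row_matrixP=> u; rewrite row_mul rowK (proj1 (hc u)).
- by move=> u l; rewrite mxE => /(proj2 (hc u))/and3P[-> ->].
- by move=> u l nJ; rewrite mxE => /(proj2 (hc u))/and3P[_ _ /implyP]; apply.
move=> u nz min_u; rewrite inJ; apply: contra nz => /submxP[D ->].
rewrite (_ : before predT u = 0) ?mulmx0 //; apply/row_matrixP=> l.
by rewrite rowK row0 ltnNge min_u.
Qed.

End Pivots.

(** * Totally isotropic subspaces and discriminants *)

Section Isotropic.
Variable K : fieldType.

Definition swap_mx (r : nat) : 'M[K]_(r + r) := block_mx 0 1%:M 1%:M 0.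

Lemma det_swap_mx_sqr r : \det (swap_mx r) ^+ 2 = 1.
Proof.
rewrite expr2 -det_mulmx mulmx_block !mulmx0 !mul0mx !mulmx1 !addr0 !add0r.
by rewrite -scalar_mx_block det1.
Qed.

(* In a basis whose first half spans the isotropic subspace the Gram matrix is
   [[0, M], [M^T, N]], and exchanging the halves makes it block triangular. *)
Lemma det_half_isotropic r (G : 'M[K]_(r + r)) (A : 'M[K]_(r, r + r)) :
  G^T = G -> row_free A -> A *m G *m A^T = 0 ->
  exists u : K, \det G = \det (swap_mx r) * u ^+ 2.
Proof.
move=> Gsym /eqP freeA AGA; pose E := row_ebase A.
have Eunit : E \in unitmx by rewrite row_ebase_unit.
have defA : A = col_ebase A *m usubmx E.
  rewrite -{1}(mulmx_ebase A) freeA -mulmxA pid_mx_row; congr (_ *m _).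
  by rewrite -[X in _ *m X](vsubmxK E) mul_row_col mul1mx mul0mx addr0.
have defU : usubmx E = invmx (col_ebase A) *m A.
  by rewrite {2}defA mulKmx // col_ebase_unit.
have isoU : usubmx E *m G *m (usubmx E)^T = 0.
  by rewrite defU trmx_mul -!mulmxA (mulmxA G) (mulmxA A) (mulmxA A) AGA mul0mx mulmx0.
pose M := usubmx E *m G *m (dsubmx E)^T; pose N := dsubmx E *m G *m (dsubmx E)^T.
have defS : E *m G *m E^T = block_mx 0 M M^T N.
  rewrite -{1 2}(vsubmxK E) tr_col_mx mul_col_mx mul_col_row isoU; congr block_mx.
  by rewrite /M !trmx_mul trmxK Gsym mulmxA.
have := congr1 (fun B => \det (B *m swap_mx r)) defS.
rewrite /= mulmx_block !mulmx0 !mulmx1 !add0r !addr0 det_lblock !det_mulmx !det_tr => detE.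
have nzE : \det E != 0 by move: Eunit; rewrite unitmxE unitfE.
exists (\det M / \det E).
have -> : \det G = \det (swap_mx r) * (\det (swap_mx r) * \det G).
  by rewrite mulrA -expr2 det_swap_mx_sqr mul1r.
congr (_ * _); rewrite expr_div_n; apply: (canRL (mulfK _)); first by rewrite sqrf_eq0.
rewrite [\det M ^+ 2]expr2 -detE; ring.
Qed.

(** An invertible [G] preserves the rank of [A], and [A^T] kills the rows of [A *m G]. *)
Lemma isotropic_rank n k (G : 'M[K]_n) (A : 'M[K]_(k, n)) :
  G \in unitmx -> A *m G *m A^T = 0 -> (\rank A + \rank A <= n)%N.
Proof.
by move=> Gu /mulmx0_rank_max; rewrite mxrank_tr mxrankMfree // row_free_unit.
Qed.

(** A totally isotropic subspace of half the dimension makes the discriminant a square up to the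
    sign [e]. *)
Lemma det_isotropic n k (G : 'M[K]_n) (A : 'M[K]_(k, n)) :
  G^T = G -> A *m G *m A^T = 0 -> n = (\rank A + \rank A)%N ->
  exists e u : K, e ^+ 2 = 1 /\ \det G = e * u ^+ 2.
Proof.
move=> Gsym AGA; have [X defB] : exists X, row_base A = X *m A.
  by apply/submxP; rewrite eq_row_base.
have BGB : row_base A *m G *m (row_base A)^T = 0.
  by rewrite defB trmx_mul -!mulmxA (mulmxA G) (mulmxA A) (mulmxA A) AGA mul0mx mulmx0.
move: (row_base_free A) BGB; move: (row_base A) => B.
move: {AGA defB B X A}(\rank A) B => r B freeB BGB nr; subst n.
have [u] := det_half_isotropic Gsym freeB BGB.
by exists (\det (swap_mx r)), u; rewrite det_swap_mx_sqr.
Qed.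

End Isotropic.

(* Index [0] stands for the constant coordinate of the homogenised point [(1, x)]. *)
Definition lift_weight (k : nat) : nat := if k is k'.+1 then 3 ^ k' else 0.

Lemma lift_weight_lt a b : (a < b)%N -> (lift_weight a + lift_weight a < lift_weight b)%N.
Proof.
case: b => // b; rewrite ltnS; case: a => [_|a lt_ab] /=; first by rewrite addn0 expn_gt0.
have: (3 ^ a.+1 <= 3 ^ b)%N by rewrite leq_exp2l.
by rewrite expnS; have: (0 < 3 ^ a)%N by [rewrite expn_gt0]; lia.
Qed.

(** If [a < a'], the left sum is at most twice the weight of [a], which is below the weight of
    [a']. *)
Lemma lift_weight_sum_inj a b a' b' : (b <= a)%N -> (b' <= a')%N ->
  (lift_weight a + lift_weight b = lift_weight a' + lift_weight b')%N ->
  a = a' /\ b = b'.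
Proof.
have mono := lift_weight_lt.
have le i j : (i <= j)%N -> (lift_weight i <= lift_weight j)%N.
  by rewrite leq_eqVlt => /predU1P[->|/mono] //; lia.
move=> /le ba /le ba' eq_s.
have [/mono|/mono|eq_a] := ltngtP a a'; [lia | lia | split=> //].
by have [/mono|/mono|//] := ltngtP b b'; move: eq_s; rewrite eq_a; lia.
Qed.

(** * Bounding the part of a fiber that lies on a quadric and in a small affine subspace *)

Section Evasive.
Variables (K : fieldType) (d m N : nat) (al g : 'I_d -> K) (c : 'I_m -> K).
Variable x : 'I_d -> 'I_N -> K.

(** The exponents [dg] complement the weights [w]: all leading powers in the fiber equations have
    the same weight [W]. *)
Let w (j : 'I_d) : nat := 3 ^ j.
Let dg (j : 'I_d) : nat := 3 ^ (d - j).
Let W : nat := 3 ^ d.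
Let y (u : 'I_d.+1) (z : 'I_N) : K := oapp (x^~ z) 1 (unlift ord0 u).
(** The entry [-1] at the constant coordinate makes the sphere equation homogeneous in [d + 1]
    variables. *)
Let gh : 'rV[K]_d.+1 := \row_u oapp g (-1) (unlift ord0 u).
Let Y : 'M[K]_(d.+1, N) := \matrix_(u, z) y u z.
Local Notation low := (low w x).

Hypothesis al_inj : injective al.
Hypothesis dm : d./2 = m.+1.
Hypothesis two_nz : 2%:R != 0 :> K.
Hypothesis g_nz : forall j, g j != 0.
(** The left side of the inequality is the determinant of [diag_mx gh]; see [det_isotropic]. *)
Hypothesis nonsquare : odd d ->
  forall e u : K, e ^+ 2 = 1 -> - \prod_j g j != e * u ^+ 2.
Hypothesis curve : forall (i : 'I_m) z, \sum_j al j ^+ i * x j z ^+ dg j = c i.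
Hypothesis sphere : forall z, \sum_j g j * x j z ^+ 2 = 1.
Hypothesis rankY : (\rank Y <= m.+2)%N.
Hypothesis sep : forall z z', (forall j, x j z = x j z') -> z = z'.

Let wdg j : (w j * dg j)%N = W.
Proof. by rewrite -expnD subnKC // ltnW. Qed.

Let W_gt0 : (0 < W)%N. Proof. by rewrite expn_gt0. Qed.

Let y0 z : y ord0 z = 1. Proof. by rewrite /y unlift_none. Qed.
Let yS j z : y (lift ord0 j) z = x j z. Proof. by rewrite /y liftK. Qed.

Let low_y (u : 'I_d.+1) : low (lift_weight u).+1 (y u).
Proof.
case: (unliftP ord0 u) => [j ->|->].
  by rewrite lift0 /=; apply: span_ext (low_var w x j) => z; rewrite yS.
by apply: span_ext (low_const w x 0 1) => z; rewrite y0.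
Qed.

Let low_pow j : low W.+1 (fun z => x j z ^+ dg j).
Proof. by rewrite -(wdg j); apply/low_exp/low_var. Qed.

Lemma curve_poly (f : {poly K}) : (size f <= m)%N ->
  exists k, forall z, \sum_j f.[al j] * x j z ^+ dg j = k.
Proof.
move=> sz_f; exists (\sum_(i < m) f`_i * c i) => z.
under eq_bigr do rewrite (horner_coef_wide _ sz_f) mulr_suml.
rewrite exchange_big; apply: eq_bigr => i _ /=; rewrite -(curve i z) mulr_sumr.
by apply: eq_bigr => j _; rewrite mulrA.
Qed.

Let van (A : {set 'I_d}) : {poly K} := \prod_(j <- enum A) ('X - (al j)%:P).

Let van_nz (A : {set 'I_d}) l : l \notin A -> (van A).[al l] != 0.
Proof.
move=> lA; rewrite /van horner_prod prodf_seq_neq0; apply/allP=> j; rewrite mem_enum /= => jA.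
by rewrite hornerXsubC subr_eq0 (inj_eq al_inj); apply: contraNneq lA => ->.
Qed.

Let van_0 (A : {set 'I_d}) l : l \in A -> (van A).[al l] = 0.
Proof.
move=> lA; rewrite /van horner_prod (big_rem l) ?mem_enum //=.
by rewrite hornerXsubC subrr mul0r.
Qed.

Section WithPivots.
Variables (J : {set 'I_d.+1}) (C : 'M[K]_d.+1).
Hypothesis YC : Y = C *m Y.
Hypothesis CJ : forall u l, C u l != 0 -> (l \in J) && (l <= u)%N.
Hypothesis CnJ : forall u l, u \notin J -> C u l != 0 -> (l < u)%N.
Let Kp := [set j : 'I_d | lift ord0 j \in J].

Let yC u z : y u z = \sum_l C u l * y l z.
Proof.
have := congr1 (fun A : 'M_(_, _) => A u z) YC; rewrite !mxE => ->.
by apply: eq_bigr => l _; rewrite mxE.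
Qed.

Lemma low_nonpivot j : j \notin Kp -> low (w j) (x j).
Proof.
rewrite inE => njJ; apply: (@span_ext _ _ _ _ _ (fun z => \sum_l C (lift ord0 j) l * y l z)).
  by move=> z; rewrite -yC yS.
apply: span_sum => l _; have [->|nzC] := eqVneq (C (lift ord0 j) l) 0.
  by apply: span_ext (span0 _ _) => z; rewrite mul0r.
apply: spanZ; apply: low_leq (low_y l).
have := lift_weight_lt (CnJ njJ nzC); rewrite lift0 /= /w; lia.
Qed.

(** The polynomial vanishing on [A] has degree [#|A| < m], so [curve_poly] applies to it. It kills
    the terms of [A]; the nonpivots and the constant have lower weight. *)
Lemma low_lagrange (A : {set 'I_d}) : A \subset Kp -> (#|A| < m)%N ->
  low W (fun z => \sum_(j in Kp :\: A) (van A).[al j] * x j z ^+ dg j).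
Proof.
move=> AK ltAm; have [|k def_k] := @curve_poly (van A).
  by rewrite size_prod_XsubC -cardE.
have Lk : low W (fun=> k) by apply: low_leq (low_const w x 0 k).
have Lrest : low W (fun z => \sum_(j | j \notin Kp) - (van A).[al j] * x j z ^+ dg j).
  apply: span_sum => j njK; apply: spanZ; rewrite -(wdg j).
  by apply: low_exp_lt (low_nonpivot njK); rewrite expn_gt0.
apply: span_ext (spanD Lk Lrest) => z.
rewrite -(def_k z) (bigID (mem Kp)) /= -addrA -big_split /=.
rewrite [X in _ + X]big1 ?addr0; last by move=> j _; rewrite mulNr subrr.
rewrite (bigID (mem A)) /= [X in X + _]big1 ?add0r; last first.
  by move=> j /andP[_ /van_0->]; rewrite mul0r.
by apply: eq_bigl => j; rewrite in_setD andbC.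
Qed.

(** The polynomial can vanish at every pivot but [l]. *)
Lemma low_pivot_small l : (#|Kp| <= m)%N -> l \in Kp ->
  low W (fun z => x l z ^+ dg l).
Proof.
move=> leKm lK; have := @low_lagrange (Kp :\ l) (subD1set _ _).
rewrite [X in (X < _)%N -> _](_ : _ = #|Kp|.-1); last by rewrite (cardsD1 l Kp) lK.
have K_gt0 : (0 < #|Kp|)%N by apply/card_gt0P; exists l.
rewrite prednK // => /(_ leKm) /(spanZ (van (Kp :\ l)).[al l]^-1).
apply: span_ext => z; rewrite (_ : Kp :\: (Kp :\ l) = [set l]); last first.
  apply/setP=> j; rewrite in_setD in_setD1 in_set1.
  by case: eqVneq => [->|_] /=; rewrite ?lK ?andNb.
by rewrite big_set1 mulKf // van_nz // !inE eqxx.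
Qed.

(** With one more pivot, two terms survive, both with nonzero coefficients. *)
Lemma low_pivot_pair l a : (#|Kp| <= m.+1)%N -> l \in Kp -> a \in Kp ->
  exists2 k, k != 0 & low W (fun z => x l z ^+ dg l - k * x a z ^+ dg a).
Proof.
move=> leKm lK aK; have [<-|ne_la] := eqVneq l a.
  exists 1; rewrite ?oner_eq0 //; apply: span_ext (span0 _ _) => z.
  by rewrite mul1r subrr.
pose A := Kp :\ l :\ a.
have cK : #|Kp| = #|A|.+2 by rewrite (cardsD1 l Kp) lK (cardsD1 a) in_setD1 eq_sym ne_la aK.
have AK : A \subset Kp by apply: subset_trans (subD1set _ _) (subD1set _ _).
have ltA : (#|A| < m)%N by rewrite -ltnS -cK.
have nl : (van A).[al l] != 0 by rewrite van_nz // !inE eqxx /= andbF.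
have na : (van A).[al a] != 0 by rewrite van_nz // !inE eqxx.
have L := spanZ (van A).[al l]^-1 (low_lagrange AK ltA).
exists (- ((van A).[al l]^-1 * (van A).[al a])).
  by rewrite oppr_eq0 mulf_neq0 // invr_neq0.
apply: span_ext L => z; rewrite (_ : Kp :\: A = l |: [set a]); last first.
  apply/setP=> j; rewrite in_setD !in_setD1 in_setU1 in_set1.
  case: (eqVneq j a) => [->|_]; first by rewrite aK orbT.
  by case: eqVneq => [->|_] /=; rewrite ?lK ?andNb.
by rewrite big_setU1 ?inE //= big_set1; field.
Qed.

(** By [Y = C *m Y], this is the Gram matrix of the homogenised form in pivot coordinates. *)
Let Gm : 'M[K]_d.+1 := C^T *m diag_mx gh *m C.

Let Gm_sym l l' : Gm l l' = Gm l' l.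
Proof.
have {1}-> : Gm = Gm^T by rewrite !trmx_mul trmxK tr_diag_mx mulmxA.
by rewrite mxE.
Qed.

Let Gm_J l l' : Gm l l' != 0 -> l' \in J.
Proof.
apply: contraR => nJ; rewrite mxE big1 // => u _.
by case: (eqVneq (C u l') 0) => [->|/CJ]; rewrite ?mulr0 // (negPf nJ).
Qed.

Let Gm_form z : \sum_(p : 'I_d.+1 * 'I_d.+1) Gm p.1 p.2 * (y p.1 z * y p.2 z) = 0.
Proof.
transitivity ((Y^T *m diag_mx gh *m Y) z z).
  have -> : Y^T *m diag_mx gh *m Y = Y^T *m Gm *m Y.
    by rewrite [in LHS]YC trmx_mul /Gm !mulmxA.
  rewrite mxE -(pair_bigA _ (fun l l' => Gm l l' * (y l z * y l' z))) /= exchange_big.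
  apply: eq_bigr => l' _; rewrite mxE mulr_suml; apply: eq_bigr => l _.
  by rewrite [Y^T _ _]mxE ![Y _ _]mxE; ring.
transitivity (\sum_u gh 0 u * y u z ^+ 2).
  rewrite mxE; apply: eq_bigr => u _; rewrite mul_mx_diag !mxE; ring.
rewrite big_ord_recl y0 mxE unlift_none /= expr1n mulr1.
rewrite (eq_bigr (fun j => g j * x j z ^+ 2)); first by rewrite sphere addNr.
by move=> j _; rewrite mxE liftK yS.
Qed.

(** The sphere relation is solved for its monomial of largest weight, unique up to order by
    [lift_weight_sum_inj]. *)
Lemma low_product : (0 < N)%N -> Gm != 0 ->
  exists a b, [/\ a \in Kp, b \in Kp & low (w a + w b) (fun z => x a z * x b z)].
Proof.
move=> N_gt0 nzG.
pose P := [pred p : 'I_d.+1 * 'I_d.+1 | (Gm p.1 p.2 != 0) && (p.2 <= p.1)%N].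
have [p0 Pp0] : exists p, P p.
  have /existsP[l /existsP[l' nz]] : [exists l, exists l', Gm l l' != 0].
    apply: contraR nzG; rewrite negb_exists => /forallP nex; apply/eqP/matrixP=> l l'.
    have := nex l; rewrite negb_exists => /forallP/(_ l').
    by rewrite negbK => /eqP->; rewrite mxE.
  by have [le|/ltnW le] := leqP l' l; [exists (l, l') | exists (l', l)];
    rewrite /= ?le ?(Gm_sym l') ?nz.
case: (arg_maxnP (fun p : 'I_d.+1 * 'I_d.+1 => lift_weight p.1 + lift_weight p.2)%N Pp0).
case=> u v /= /andP[nz le_vu] maxw.
pose D := [set (u, v); (v, u)].
have small (l l' : 'I_d.+1) : Gm l l' != 0 -> (l, l') \notin D ->
    (lift_weight l + lift_weight l' < lift_weight u + lift_weight v)%N.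
  wlog le : l l' / (l' <= l)%N => [WL nzl nD|].
    have [le|/ltnW le] := leqP l' l; first exact: WL.
    rewrite addnC; apply: WL => //; first by rewrite Gm_sym.
    by apply: contra nD; rewrite !inE !xpair_eqE => /orP[] /andP[-> ->]; rewrite ?orbT.
  move=> nzl; rewrite !inE negb_or => /andP[ne _].
  have := maxw (l, l'); rewrite /= nzl le => /(_ isT).
  rewrite /= leq_eqVlt => /predU1P[eqw|//]; case/eqP: ne.
  by case: (lift_weight_sum_inj le le_vu eqw) => /val_inj-> /val_inj->.
have Lrest : low (lift_weight u + lift_weight v)
    (fun z => \sum_(p in ~: D) - Gm p.1 p.2 * (y p.1 z * y p.2 z)).
  apply: span_sum => -[l l'] /=; rewrite inE => nD; have [->|nzl] := eqVneq (Gm l l') 0.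
    by apply: span_ext (span0 _ _) => z; rewrite oppr0 mul0r.
  by apply/spanZ/(low_leq (small l l' nzl nD))/lowM; apply: low_y.
(* The monomial occurs once if [u = v] and twice otherwise; 2 is nonzero in [K]. *)
pose k : K := #|D|%:R * Gm u v.
have nzk : k != 0.
  by rewrite /k mulf_neq0 // /D cards2; case: ((u, v) != _); rewrite ?oner_eq0.
have Luv : low (lift_weight u + lift_weight v) (fun z => y u z * y v z).
  apply: span_ext (spanZ k^-1 Lrest) => z.
  have := Gm_form z; rewrite (bigID (mem D)) /= => /eqP; rewrite addrC addr_eq0 => /eqP E.
  rewrite (eq_bigl (fun p => p \notin D)); last by move=> p; rewrite inE.
  under eq_bigr do rewrite mulNr.
  rewrite sumrN E opprK (eq_bigr (fun=> Gm u v * (y u z * y v z))).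
    by rewrite sumr_const -[_ *+ _]mulr_natl [_%:R * _]mulrA mulKf.
  by move=> p; rewrite !inE => /orP[] /eqP-> //=; rewrite Gm_sym [y v z * _]mulrC.
have vJ : v \in J := Gm_J nz.
have uJ : u \in J by apply: (@Gm_J v); rewrite Gm_sym.
(* If [u] is the constant coordinate then so is [v], and the constant 1 would be in [low 0]. *)
case: (unliftP ord0 u) => [a def_u|u0]; last first.
  move: Luv; have -> : v = ord0 by apply/val_inj; move: le_vu; rewrite u0 /=; lia.
  rewrite u0 => /low0/(_ (Ordinal N_gt0))/eqP.
  by rewrite !y0 mulr1 oner_eq0.
have aK : a \in Kp by rewrite inE -def_u.
case: (unliftP ord0 v) => [b def_v|v0].
  exists a, b; split=> //; first by rewrite inE -def_v.
  by move: Luv; rewrite def_u def_v !lift0; apply: span_ext => z; rewrite !yS.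
(* Here the relation is affine with leading term [x a], so the square of [x a] is low as well. *)
exists a, a; split=> //; rewrite addnn -muln2.
have La : low (w a) (x a).
  move: Luv; rewrite def_u v0 lift0 /= addn0.
  by apply: span_ext => z; rewrite yS y0 mulr1.
by apply: span_ext (low_exp_lt (ltn0Sn 1) La) => z; rewrite expr2.
Qed.

(** In the [W]-th power of [x a * x b], the factor [x b ^ W] is the [w b]-th power of [x b ^ dg b],
    so it can be traded for a power of [x a]. Proportionality then passes the resulting pure power
    to every pivot. *)
Lemma low_pivot_quadric l : (0 < N)%N -> (#|Kp| <= m.+1)%N -> Gm != 0 -> l \in Kp ->
  exists2 h, (0 < h <= 2 * W)%N & low (W * h) (fun z => x l z ^+ (dg l * h)).
Proof.
move=> N_gt0 leKm /(low_product N_gt0)[a [b [aK bK Lab]]] lK.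
have wW j : (w j <= W)%N by rewrite leq_exp2l // ltnW.
have w_gt0 j : (0 < w j)%N by rewrite expn_gt0.
exists (w a + w b)%N; first by have := wW a; have := wW b; have := w_gt0 a; lia.
have [k nzk Lba] := low_pivot_pair leKm bK aK.
have scaled k' : low W.+1 (fun z => k' * x a z ^+ dg a) by apply/spanZ/low_pow.
have La : low (W * (w a + w b)) (fun z => x a z ^+ (dg a * (w a + w b))).
  have L1 := low_exp_lt W_gt0 Lab.
  have L2 := low_congr_exp (w b) (low_pow b) (scaled k) Lba.
  have L3 := lowM_lt (low_exp W (low_var w x a)) L2.
  rewrite -[(W * (w a + w b))%N]mulnC; rewrite [(W * w b)%N]mulnC -mulnDl in L3.
  apply: span_ext (spanZ (k ^+ w b)^-1 (spanD L1 (spanZ (-1) L3))) => z.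
  rewrite exprMn mulrBr -[x b z ^+ dg b ^+ _]exprM [(dg b * _)%N]mulnC wdg.
  rewrite mulN1r opprB addrC subrK exprMn mulrCA mulKf ?expf_neq0 // -exprM.
  by rewrite -exprD mulnDr [(dg a * w a)%N]mulnC wdg.
have [k' _ Lla] := low_pivot_pair leKm lK aK.
have L := low_congr_exp (w a + w b) (low_pow l) (scaled k') Lla.
apply: span_ext (spanD L (spanZ (k' ^+ (w a + w b)) La)) => z.
by rewrite exprMn -!exprM subrK.
Qed.

End WithPivots.

Lemma evasive_bound : (N <= (2 * 9 ^ d) ^ d)%N.
Proof.
have [->//|N_gt0] := posnP N.
have [J [C [cardJ YC CJ CnJ J0]]] := echelon_pivots Y.
pose Kp := [set j : 'I_d | lift ord0 j \in J].
(* The constant coordinate is a pivot and uses up one unit of rank. *)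
have cardK : (#|Kp| < #|J|)%N.
  have J_0 : ord0 \in J.
    apply: J0 => //; apply/eqP=> /rowP/(_ (Ordinal N_gt0))/eqP.
    by rewrite !mxE y0 oner_eq0.
  rewrite (cardsD1 ord0 J) J_0 add1n ltnS -(card_imset _ (@lift_inj _ ord0)).
  apply: subset_leq_card; apply/subsetP=> _ /imsetP[j jK ->].
  by rewrite !inE in jK *; rewrite jK andbT.
have piv l : l \in Kp ->
    exists2 h, (0 < h <= 2 * W)%N & low (W * h) (fun z => x l z ^+ (dg l * h)).
  move=> lK; have [rk|rk] := leqP (\rank Y) m.+1.
    exists 1%N; first by lia.
    rewrite !muln1; apply: (low_pivot_small YC CnJ) lK.
    by rewrite -ltnS (leq_trans cardK) // (leq_trans cardJ).
  have rk2 : \rank Y = m.+2 by apply/eqP; rewrite eqn_leq rankY.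
  apply: (low_pivot_quadric YC CJ CnJ N_gt0) lK.
    by rewrite -ltnS (leq_trans cardK) // (leq_trans cardJ).
  (* Otherwise the rows of [C^T] span a totally isotropic subspace of dimension at least [m + 2],
     while [d + 1] is [2m + 3] or [2m + 4]. *)
  apply/eqP=> G0.
  have rkC : (m.+2 <= \rank C^T)%N by rewrite mxrank_tr -rk2 {1}YC mxrankM_maxl.
  have iso : C^T *m diag_mx gh *m (C^T)^T = 0 by rewrite trmxK.
  have detG : \det (diag_mx gh) = - \prod_j g j.
    rewrite det_diag big_ord_recl mxE unlift_none mulN1r; congr (- _).
    by apply: eq_bigr => j _; rewrite mxE liftK.
  have Gu : diag_mx gh \in unitmx.
    by rewrite unitmxE unitfE detG oppr_eq0; apply/prodf_neq0 => j _.
  have := isotropic_rank Gu iso; have := odd_double_half d.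
  rewrite dm -addnn; case: (boolP (odd d)) => [od|_]; last by lia.
  move=> eq_d rk_le.
  have [|e [u [e1 eq_det]]] := det_isotropic (tr_diag_mx gh) iso; first by lia.
  by have := nonsquare od u e1; rewrite -detG eq_det eqxx.
rewrite -[X in (X <= _)%N](card_ord N) -[X in (_ <= _ ^ X)%N](card_ord d).
apply: (@card_le_of_low _ _ _ w x) => // j.
(* Every exponent [dg j * h] is at most [W * (2 * W) = 2 * 9 ^ d]. *)
have dW : (dg j <= W)%N by rewrite leq_exp2l // leq_subr.
have E9 : (9 ^ d = W * W)%N by rewrite -expnMn.
have [/piv[h /andP[h_gt0 h_le]]|njK] := boolP (j \in Kp).
  rewrite -(wdg j) -mulnA; apply: low_expW; rewrite E9; nia.
apply: (@low_expW _ _ _ _ _ _ 1); first by rewrite E9; nia.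
rewrite muln1; apply: span_ext (low_nonpivot YC CnJ njK) => z.
by rewrite expr1.
Qed.

End Evasive.

(** * Diagonal quadratic forms over a finite field *)

Section DiagonalForm.
Variables (K : finFieldType) (d : nat) (g : 'I_d -> K).

Definition qform (v : 'rV[K]_d) : K := \sum_j g j * v 0 j ^+ 2.

Lemma qformN v : qform (- v) = qform v.
Proof. by apply: eq_bigr => j _; rewrite mxE sqrrN. Qed.

Lemma qform0 : qform 0 = 0.
Proof. by rewrite /qform big1 // => j _; rewrite mxE expr0n mulr0. Qed.

(** For [v0] in [Z] the rank is the dimension of the affine span of [Z]. *)
Definition differences (Z : {set 'rV[K]_d}) (v0 : 'rV[K]_d) : 'M[K]_(#|Z|, d) :=
  \matrix_(k < #|Z|) (enum_val k - v0).

Lemma differences_rank_subset (Z Z' : {set 'rV[K]_d}) v0 : Z \subset Z' ->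
  (\rank (differences Z v0) <= \rank (differences Z' v0))%N.
Proof.
move=> ZZ'; apply/mxrankS/row_subP=> k; rewrite rowK.
have kZ' : enum_val k \in Z' by apply: (subsetP ZZ'); apply: enum_valP.
apply: submx_trans (row_sub (enum_rank_in kZ' (enum_val k)) (differences Z' v0)).
by rewrite rowK enum_rankK_in.
Qed.

(* By polarisation the directions spanned by [A] and by [B] are orthogonal. *)
Lemma differences_rank_sum (A B : {set 'rV[K]_d}) a0 b0 :
    2%:R != 0 :> K -> (forall j, g j != 0) -> a0 \in A -> b0 \in B ->
    (forall a b, a \in A -> b \in B -> qform (b - a) = 1) ->
  (\rank (differences A a0) + \rank (differences B b0) <= d)%N.
Proof.
move=> nz2 nzg Aa0 Bb0 unitAB; pose G : 'M[K]_d := diag_mx (\row_j g j).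
have Gu : G \in unitmx.
  by rewrite unitmxE unitfE det_diag; apply/prodf_neq0 => j _; rewrite mxE.
rewrite -(mxrank_tr (differences B b0)) -(mxrankMfree (differences A a0) (B := G)).
  apply: mulmx0_rank_max; apply/matrixP=> i k; rewrite !mxE.
  set a := enum_val i; set b := enum_val k.
  have Aa : a \in A := enum_valP i; have Bb : b \in B := enum_valP k.
  apply: (mulfI nz2); rewrite mulr0.
  (* The alternating sum is twice the bilinear form at [a - a0] and [b - b0]. *)
  have : qform (b - a0) + qform (b0 - a) - qform (b - a) - qform (b0 - a0) = 0.
    by rewrite !unitAB //; ring.
  apply: etrans; rewrite /qform -big_split -!sumrB mulr_sumr /=; apply: eq_bigr => j _.
  by rewrite mul_mx_diag !mxE; ring.
by rewrite row_free_unit.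
Qed.

(** The coordinates [j0] and [j1] span a hyperbolic plane: given the other coordinates and a nonzero
    value of [x_j0 + i x_j1], the equation determines [x_j0 - i x_j1]. *)
Lemma card_unit_quadric (i : K) (j0 j1 : 'I_d) :
    2%:R != 0 :> K -> i ^+ 2 = -1 -> j0 != j1 -> g j0 = 1 -> g j1 = 1 ->
  (#|K| ^ d <= 2 * (#|[set v | qform v == 1%R]| * #|K|))%N.
Proof.
move=> nz2 i2 ne g0 g1; have nzi : i != 0.
  by apply: contra_eq_neq i2 => ->; rewrite expr0n eq_sym oppr_eq0 oner_eq0.
have nz4 : 4%:R != 0 :> K by rewrite (natrM _ 2 2) mulf_neq0.
pose D := [set v : 'rV[K]_d | v 0 j0 != 0].
pose rest (v : 'rV[K]_d) := \sum_(j | (j != j0) && (j != j1)) g j * v 0 j ^+ 2.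
pose s v := (1 - rest v) / v 0 j0.
pose pt (v : 'rV[K]_d) : 'rV[K]_d := \row_j if j == j0 then (v 0 j0 + s v) / 2%:R
  else if j == j1 then (v 0 j0 - s v) / (2%:R * i) else v 0 j.
have pt0 v : pt v 0 j0 = (v 0 j0 + s v) / 2%:R by rewrite mxE eqxx.
have pt1 v : pt v 0 j1 = (v 0 j0 - s v) / (2%:R * i).
  by rewrite mxE eqxx eq_sym (negPf ne).
have ptj v j : j != j0 -> j != j1 -> pt v 0 j = v 0 j.
  by rewrite mxE => /negPf-> /negPf->.
have sphere v : v \in D -> qform (pt v) = 1.
  rewrite inE => nzv; rewrite /qform (bigD1 j0) //= (bigD1 j1) 1?eq_sym //=.
  rewrite (_ : \sum_(j | _) _ = rest v); last first.
    by apply: eq_bigr => j /andP[n0 n1]; rewrite ptj.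
  rewrite g0 g1 !mul1r pt0 pt1 !expr_div_n exprMn i2.
  rewrite /s; field.
  by rewrite oppr_eq0 nz4 nzv.
have inj : {in D &, injective (fun v => (pt v, v 0 j1))}.
  move=> v v' _ _ [eq_pt eq1]; apply/rowP=> j.
  have [->|n1] := eqVneq j j1; first exact: eq1.
  have [->|n0] := eqVneq j j0; last by rewrite -(ptj v) // eq_pt ptj.
  have rec (u : 'rV[K]_d) : u 0 j0 = pt u 0 j0 + i * pt u 0 j1.
    by rewrite pt0 pt1; field; rewrite ?nzi ?nz2.
  by rewrite rec eq_pt -rec.
have leD : (#|D| <= #|[set v | qform v == 1%R]| * #|K|)%N.
  rewrite -(card_in_imset inj) -cardsT -cardsX; apply: subset_leq_card.
  by apply/subsetP=> _ /imsetP[v Dv ->]; rewrite !inE andbT sphere.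
apply: leq_trans (leq_mul (leqnn 2) leD).
rewrite -[X in (_ ^ X)%N]mul1n -card_mx -(cardsC D) mul2n -addnn leq_add2l.
(* Replacing a zero coordinate by 1 shows that [D] holds at least half of all vectors. *)
pose f (v : 'rV[K]_d) : 'rV[K]_d := \row_j if j == j0 then 1 else v 0 j.
have injf : {in ~: D &, injective f}.
  move=> v v'; rewrite !inE !negbK => /eqP v0 /eqP v'0 eqf; apply/rowP=> j.
  have := congr1 (fun u : 'rV_d => u 0 j) eqf; rewrite !mxE.
  by case: eqP => [->|//]; rewrite v0 v'0.
rewrite -(card_in_imset injf); apply: subset_leq_card; apply/subsetP=> _ /imsetP[v _ ->].
by rewrite inE mxE eqxx oner_eq0.
Qed.

End DiagonalForm.

(** * Fibers of the additive map *)

Section Twist.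
Variables (K : finFieldType) (d m : nat) (al g : 'I_d -> K).
Hypothesis char3 : 3%N \in [char K].

Definition twist (v : 'rV[K]_d) : 'rV[K]_m :=
  \row_(i < m) \sum_j al j ^+ i * v 0 j ^+ (3 ^ (d - j)).

Lemma twistD u v : twist (u + v) = twist u + twist v.
Proof.
apply/rowP=> i; rewrite !mxE -big_split; apply: eq_bigr => j _ /=.
rewrite mxE exprDn_pchar ?mulrDr // pnatX; apply/orP; left.
by rewrite pnatE.
Qed.

Lemma twist0 : twist 0 = 0.
Proof. by apply: (addrI (twist 0)); rewrite -twistD !addr0. Qed.

Lemma twistN v : twist (- v) = - twist v.
Proof. by apply: (addrI (twist v)); rewrite -twistD !subrr twist0. Qed.

Definition fiber (t : 'rV[K]_m) : {set 'rV[K]_d} := [set v | twist v == t].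

Lemma card_fiber v : #|fiber (twist v)| = #|fiber 0|.
Proof.
rewrite -(card_imset (fiber 0) (addIr v)); apply: eq_card => u; apply/idP/imsetP.
  rewrite inE => /eqP tu; exists (u - v); rewrite ?subrK //.
  by rewrite inE twistD twistN tu subrr.
by case=> u'; rewrite !inE => /eqP t0 ->; rewrite twistD t0 add0r.
Qed.

(** At most [#|K| ^ m] fibers cover the space, and the nonempty ones are translates of [fiber 0]. *)
Lemma card_fiber_ge : (m <= d)%N -> (#|K| ^ (d - m) <= #|fiber 0|)%N.
Proof.
move=> le_md; have K_gt0 : (0 < #|K| ^ m)%N.
  by rewrite expn_gt0; apply/orP; left; apply/card_gt0P; exists 0.
have cV k : (#|K| ^ k = #|{: 'rV[K]_k}|)%N by rewrite card_mx mul1n.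
rewrite -(leq_pmul2r K_gt0) -expnD subnK // !cV.
apply: (@leq_trans (\sum_(t : 'rV[K]_m) #|fiber 0|)); last by rewrite sum_nat_const mulnC.
rewrite -[#|{: 'rV[K]_d}|]sum1_card (partition_big twist predT) //=.
apply: leq_sum => t _; rewrite sum1_card.
have [/existsP[v /eqP <-]|] := boolP [exists v, twist v == t].
  by rewrite -(card_fiber v); apply: eq_leq; apply: eq_card => u; rewrite !inE.
rewrite negb_exists => /forallP no_v; rewrite eq_card0 // => u.
by rewrite unfold_in; apply: negPf (no_v u).
Qed.

(** Averaging over [v]: each [u] on the quadric lies in [fiber (twist v)] for exactly [#|fiber 0|]
    vectors [v]. *)
Lemma rich_fiber : exists v,
  (#|[set u | qform g u == 1%R]| * #|fiber 0| <=
     #|[set u in fiber (twist v) | qform g u == 1%R]| * #|K| ^ d)%N.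
Proof.
pose S := [set u | qform g u == 1]; pose Sv v := [set u in fiber (twist v) | qform g u == 1].
have sumS : (\sum_v #|Sv v| = #|S| * #|fiber 0|)%N.
  transitivity (\sum_v \sum_(u in S) (twist u == twist v))%N.
    apply: eq_bigr => v _; rewrite -sum1_card big_mkcond [RHS]big_mkcond.
    by apply: eq_bigr => u _; rewrite !inE; case: (_ == 1); case: (_ == _).
  rewrite exchange_big -sum_nat_const; apply: eq_bigr => u _.
  rewrite -(card_fiber u) -sum1_card [RHS]big_mkcond; apply: eq_bigr => v _.
  by rewrite inE eq_sym; case: (_ == _).
apply/existsP; apply: contraTT isT; rewrite negb_exists => /forallP no_v.
have : (\sum_v (#|Sv v| * #|K| ^ d).+1 <= \sum_(v : 'rV[K]_d) #|S| * #|fiber 0|)%N.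
  by apply: leq_sum => v _; have := no_v v; rewrite -ltnNge.
under eq_bigr do rewrite -addn1.
rewrite big_split /= -big_distrl /= sumS !sum_nat_const card_mx mul1n muln1.
rewrite [(_ * (#|S| * _))%N]mulnC -leq_subRL ?subnn // leqn0 expn_eq0.
by case/andP=> /eqP/card0_eq/(_ 0).
Qed.

End Twist.

(** * Thinning a graph to a given number of vertices *)

Section Deletion.
Variables (T : finType) (e : rel T).
Hypothesis irr : irreflexive e.

Definition arcs (P : {set T}) : {set T * T} :=
  [set p | [&& p.1 \in P, p.2 \in P & e p.1 p.2]].

(** Averaging over [v]: an arc has two distinct ends, so it survives [#|P| - 2] of the deletions. *)
Lemma arcs_delete (P : {set T}) : (0 < #|P|)%N ->
  exists2 v, v \in P & (#|arcs P| * (#|P| - 2) <= #|arcs (P :\ v)| * #|P|)%N.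
Proof.
move=> P_gt0.
have sumE : (\sum_(v in P) #|arcs (P :\ v)| = #|arcs P| * (#|P| - 2))%N.
  transitivity (\sum_(v in P) \sum_(p in arcs P) ((p.1 != v) && (p.2 != v)))%N.
    apply: eq_bigr => v _; rewrite -sum1_card big_mkcond [RHS]big_mkcond.
    apply: eq_bigr => p _; rewrite !inE.
    by case: (p.1 \in P); case: (p.2 \in P); case: (e _ _);
      rewrite ?andbT ?andbF //; case: (_ && _).
  rewrite exchange_big -sum_nat_const; apply: eq_bigr => p; rewrite inE => /and3P[P1 P2 e12].
  have ne : p.2 != p.1 by apply: contraTneq e12 => ->; rewrite irr.
  have -> : (#|P| - 2 = #|P :\ p.1 :\ p.2|)%N.
    by rewrite (cardsD1 p.1 P) P1 (cardsD1 p.2 (P :\ p.1)) in_setD1 ne P2 addnA addKn.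
  rewrite -sum1_card big_mkcond [RHS]big_mkcond; apply: eq_bigr => v _; rewrite !inE.
  by rewrite ![v == _]eq_sym; case: (v \in P); case: eqP; case: eqP.
apply/exists_inP; apply: contraTT isT; rewrite negb_exists_in => /forall_inP no_v.
have : (\sum_(v in P) (#|arcs (P :\ v)| * #|P|).+1 <=
        \sum_(v in P) #|arcs P| * (#|P| - 2))%N.
  by apply: leq_sum => v Pv; rewrite ltnNge no_v.
under eq_bigr do rewrite -addn1.
rewrite big_split /= -big_distrl /= sumE !sum_nat_const muln1.
by rewrite [X in (_ <= X)%N]mulnC -leq_subRL ?subnn // leqNgt P_gt0.
Qed.

(** Such deletions never lower the density [#|arcs P| / (#|P| (#|P| - 1))]. *)
Lemma arcs_subset (P : {set T}) n : (1 < n <= #|P|)%N ->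
  exists P' : {set T}, [/\ P' \subset P, #|P'| = n &
    (#|arcs P| * (n * n.-1) <= #|arcs P'| * (#|P| * #|P|.-1))%N].
Proof.
case/andP=> n_gt1; have [k] := ubnP #|P|; elim: k => // k IHk in P *.
rewrite ltnS => leP; rewrite leq_eqVlt => /predU1P[->|ltP]; first by exists P.
have [v Pv le1] := arcs_delete (leq_ltn_trans (leq0n n) ltP).
have cP : #|P| = #|P :\ v|.+1 by rewrite (cardsD1 v P) Pv.
have [||P' [sub cP' le2]] := IHk (P :\ v).
- by rewrite -cP.
- by rewrite -ltnS -cP.
exists P'; split=> //; first exact: subset_trans sub (subD1set _ _).
rewrite cP in le1 ltP *; move: le1 le2.
set a := #|arcs P|; set b := #|arcs (P :\ v)|; set c := #|arcs P'|; set N := #|P :\ v|.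
rewrite -/N in ltP; move=> le1 le2.
have N_gt : (0 < N - 1)%N by lia.
rewrite -(leq_pmul2r N_gt) /=; nia.
Qed.

End Deletion.

(** * The graph of the quadratic form on two fibers *)

Section UnitQuadricGraph.
Variables (K : finFieldType) (d m : nat) (al g : 'I_d -> K).
Hypothesis char3 : 3%N \in [char K].
Hypothesis al_inj : injective al.
Hypothesis dm : d./2 = m.+1.
Hypothesis g_nz : forall j, g j != 0.
Hypothesis nonsquare : odd d ->
  forall e u : K, e ^+ 2 = 1 -> - \prod_j g j != e * u ^+ 2.

Let bound := ((2 * 9 ^ d) ^ d)%N.
Local Notation fiber := (@fiber K d m al).
Local Notation twist := (@twist K d m al).

Let nz2 : 2%:R != 0 :> K.
Proof. by rewrite -(dvdn_pcharf char3). Qed.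

(** Translation by [-a] centres the quadric at 0 and, by additivity of [twist], maps fibers to
    fibers. *)
Lemma card_fiber_quadric (Z : {set 'rV[K]_d}) (a b0 : 'rV[K]_d) (t : 'rV[K]_m) :
    Z \subset fiber t -> (forall v, v \in Z -> qform g (v - a) = 1) ->
    (\rank (differences Z b0) <= m.+1)%N ->
  (#|Z| <= bound)%N.
Proof.
move=> Zt Za rkZ; pose x (j : 'I_d) (z : 'I_#|Z|) : K := (enum_val z - a) 0 j.
apply: (@evasive_bound K d m #|Z| al g (fun i => (t - twist a) 0 i) x) => //.
- move=> i z; have := subsetP Zt _ (enum_valP z); rewrite inE => /eqP <-.
  by rewrite -twistN // -twistD // mxE.
- by move=> z; apply: Za; apply: enum_valP.
(* Each homogenised point is [k] plus an embedded difference, so the rank grows by at most one. *)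
- pose L : 'M[K]_(d.+1, d) := \matrix_(u, j) (u == lift ord0 j)%:R.
  pose k : 'cV[K]_d.+1 := \col_u oapp (fun j => (b0 - a) 0 j) 1 (unlift ord0 u).
  rewrite (_ : \matrix_(u, z) _ = k *m const_mx 1 + L *m (differences Z b0)^T).
    apply: leq_trans (mxrank_add _ _) _; rewrite -[m.+2]add1n; apply: leq_add.
      by apply: leq_trans (mxrankM_maxl _ _) (rank_leq_col _).
    by apply: leq_trans (mxrankM_maxr _ _) _; rewrite mxrank_tr.
  apply/matrixP=> u z; rewrite !mxE big_ord1 !mxE mulr1.
  case: (unliftP ord0 u) => [j ->|->]; last first.
    by rewrite /= big1 ?addr0 // => j _; rewrite !mxE /= mul0r.
  rewrite /= (bigD1 j) //= !mxE eqxx mul1r big1 ?addr0; first by rewrite /x !mxE; ring.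
  by move=> j' ne; rewrite !mxE (inj_eq lift_inj) eq_sym (negPf ne) mul0r.
move=> z z' eqx; apply: enum_val_inj; apply: (addIr (- a)); apply/rowP=> j.
exact: eqx.
Qed.

Lemma card_two_fibers (B : {set 'rV[K]_d}) (a b0 : 'rV[K]_d) (t : 'rV[K]_m) :
    B \subset fiber 0 :|: fiber t -> (forall v, v \in B -> qform g (v - a) = 1) ->
    (\rank (differences B b0) <= m.+1)%N ->
  (#|B| <= 2 * bound)%N.
Proof.
move=> Bt Ba rkB; rewrite -(setIidPl Bt) setIUr mul2n -addnn.
apply: leq_trans (leq_card_setU _ _) _.
by apply: leq_add; apply: (@card_fiber_quadric _ a b0) (subsetIr _ _) _ _;
  rewrite ?(leq_trans (differences_rank_subset _ (subsetIl _ _))) // => v /setIP[/Ba].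
Qed.

(** The two ranks add up to at most [d <= 2m + 3], so one of them is at most [m + 1]. *)
Lemma no_biclique (A B : {set 'rV[K]_d}) (t : 'rV[K]_m) :
    A \subset fiber 0 :|: fiber t -> B \subset fiber 0 :|: fiber t ->
    (forall a b, a \in A -> b \in B -> qform g (b - a) = 1) ->
  (2 * bound < #|A|)%N -> (2 * bound < #|B|)%N -> False.
Proof.
move=> At Bt AB cA cB.
have /card_gt0P[a0 Aa0] : (0 < #|A|)%N := leq_ltn_trans (leq0n _) cA.
have /card_gt0P[b0 Bb0] : (0 < #|B|)%N := leq_ltn_trans (leq0n _) cB.
have := differences_rank_sum nz2 g_nz Aa0 Bb0 AB.
have := odd_double_half d; rewrite dm -addnn => eq_d rk_d.
have [rkA|rkA] := leqP (\rank (differences A a0)) m.+1.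
  move: cA; rewrite ltnNge (card_two_fibers (a := b0) At _ rkA) // => v Av.
  by rewrite -opprB qformN AB.
have rkB : (\rank (differences B b0) <= m.+1)%N by have := leq_b1 (odd d); lia.
move: cB; rewrite ltnNge (card_two_fibers (a := a0) Bt _ rkB) // => v Bv.
exact: AB.
Qed.

Lemma dense_biclique_free n :
    (#|K| ^ d <= 2 * (#|[set v | qform g v == 1%R]| * #|K|))%N ->
    (1 < n <= #|K| ^ (d - m))%N ->
  exists P : {set 'rV[K]_d}, [/\ #|P| = n,
    forall A B : {set 'rV[K]_d}, A \subset P -> B \subset P ->
      (forall a b, a \in A -> b \in B -> qform g (b - a) = 1) ->
      (2 * bound < #|A|)%N -> (2 * bound < #|B|)%N -> False
    & (n * n <= 16 * (#|K| * #|arcs (fun a b => qform g (b - a) == 1%R) P|))%N].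
Proof.
move=> sphere_ge /andP[n_gt1 n_le]; pose adj (a b : 'rV[K]_d) := qform g (b - a) == 1.
have [v rich] := rich_fiber m al g char3.
pose t := twist v; pose P := fiber 0 :|: fiber t.
have irr : irreflexive adj by move=> a; rewrite /adj subrr qform0 eq_sym oner_eq0.
have le_md : (m <= d)%N by have := odd_double_half d; rewrite dm -addnn; lia.
have N0_ge := card_fiber_ge al char3 le_md.
have nP : (1 < n <= #|P|)%N.
  rewrite n_gt1; apply: leq_trans n_le (leq_trans N0_ge _).
  by apply: subset_leq_card; apply: subsetUl.
have [P' [subP cP' le_arcs]] := arcs_subset irr nP.
exists P'; split=> //.
  by move=> A B AP BP; apply: (@no_biclique _ _ t); apply: subset_trans subP.
have cP : (#|P| <= 2 * #|fiber 0|)%N.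
  by rewrite mul2n -addnn -{2}(card_fiber m al char3 v) leq_card_setU.
set St := [set u in fiber t | qform g u == 1].
(* A point [a] of [fiber 0] and a unit vector [u] of [fiber t] give the arc from [a] to [a + u]. *)
have arcsP : (#|fiber 0| * #|St| <= #|arcs adj P|)%N.
  rewrite -cardsX -(@card_imset _ _ (fun p : _ * _ => (p.1, p.1 + p.2))); last first.
    by move=> [a b] [a' b'] /= [eq_a]; rewrite eq_a => /addrI->.
  apply: subset_leq_card; apply/subsetP=> p /imsetP[[a b]].
  rewrite !inE /= => /andP[/eqP a0 /andP[/eqP tb qb]] ->.
  by rewrite /= twistD // a0 tb add0r !eqxx orbT /adj addrAC subrr add0r.
have K_gt0 : (0 < #|K|)%N by apply/card_gt0P; exists 0.
have Kd_gt0 : (0 < #|K| ^ d)%N by rewrite expn_gt0 K_gt0.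
have St_ge : (#|fiber 0| <= 2 * #|K| * #|St|)%N.
  rewrite -(leq_pmul2r Kd_gt0); move: rich; rewrite -/t -/St => rich.
  rewrite -mulnA; apply: leq_trans (leq_mul (leqnn (2 * #|K|)) rich).
  by rewrite mulnC mulnA leq_mul2r -mulnA [(#|K| * _)%N]mulnC sphere_ge orbT.
have N0_gt0 : (0 < #|fiber 0| * #|fiber 0|)%N.
  by rewrite muln_gt0 andbb (leq_trans _ (leq_trans n_le N0_ge)) // ltnW.
rewrite -(leq_pmul2r N0_gt0).
move: cP arcsP St_ge le_arcs n_gt1; rewrite -/adj.
set N0 := #|fiber 0|; set N := #|P|; set S := #|St|; set E := #|arcs adj P|.
set E' := #|arcs adj P'|; set q := #|K| => cP arcsP St_ge le_arcs n_gt1.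
have le1 : (N0 * N0 <= 2 * q * E)%N.
  apply: leq_trans (leq_mul (leqnn _) St_ge) _.
  by rewrite mulnCA leq_mul.
have le2 : (N * N.-1 <= 4 * (N0 * N0))%N.
  apply: leq_trans (leq_mul cP (leq_trans (leq_pred N) cP)) _.
  by rewrite mulnACA.
have le3 : (n * n <= 2 * (n * n.-1))%N by rewrite mulnCA leq_mul //; lia.
(* The constants 2, 2 and 4 of [le3], [le1] and [le2] multiply to 16. *)
apply: leq_trans (leq_mul le3 le1) _.
have -> : (2 * (n * n.-1) * (2 * q * E) = 4 * q * (E * (n * n.-1)))%N by ring.
apply: leq_trans (leq_mul (leqnn _) (leq_trans le_arcs (leq_mul (leqnn _) le2))) _.
by apply: eq_leq; ring.
Qed.

End UnitQuadricGraph.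

(** * Square roots in finite fields *)

(** [X^(2h) - 1] cannot vanish at all [4h] nonzero elements; where it does not, [x^(2h) = -1]. *)
Lemma finField_sqrtN1 (K : finFieldType) h : #|K| = (4 * h).+1 -> exists i : K, i ^+ 2 = -1.
Proof.
move=> cK; have h_gt0 : (0 < h)%N.
  by have := finNzRing_gt1 K; rewrite cK; case: (h).
have [x nzx x2h] : exists2 x : K, x != 0 & x ^+ (2 * h) != 1.
  apply/exists_inP; apply: contraTT isT; rewrite negb_exists_in => /forall_inP all1.
  have roots : all (root ('X^(2 * h) - 1%:P : {poly K})) (enum (predC1 (0 : K))).
    apply/allP=> x; rewrite mem_enum => /all1; rewrite negbK => /eqP x1.
    by rewrite rootE !hornerE x1 subrr.
  have sz := @size_XnsubC K (2 * h) 1; rewrite muln_gt0 h_gt0 in sz.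
  have := max_poly_roots _ roots (enum_uniq _); rewrite sz // -cardE.
  rewrite -size_poly_eq0 sz // => /(_ isT).
  by have := cardC1 (0 : K); rewrite cK /= => ->; lia.
have x4h : x ^+ (4 * h) = 1.
  by apply: (mulfI nzx); rewrite -exprS -cK expf_card mulr1.
exists (x ^+ h); apply/eqP; rewrite -exprM mulnC.
have : (x ^+ (2 * h)) ^+ 2 == 1 by rewrite -exprM -x4h; apply/eqP; congr (_ ^+ _); lia.
by rewrite sqrf_eq1 (negPf x2h).
Qed.

(** Squaring identifies 1 and -1, so on a finite field it is not onto. *)
Lemma finField_nonsquare (K : finFieldType) : 2%:R != 0 :> K ->
  exists de : K, forall u, u ^+ 2 != de.
Proof.
move=> nz2; have ne1 : (1 : K) != -1 by rewrite -subr_eq0 opprK.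
have : ~~ [forall de : K, de \in [set u ^+ 2 | u in [set: K]]].
  apply: contra ne1 => /forallP onto.
  have /imset_injP inj : #|[set u ^+ 2 | u in [set: K]]| == #|[set: K]|.
    by apply/eqP/eq_card => u; rewrite onto inE.
  by apply/eqP/inj; rewrite ?inE ?sqrrN.
rewrite negb_forall => /existsP[de nde]; exists de => u.
by apply: contraNneq nde => <-; apply: imset_f; rewrite inE.
Qed.

Lemma finField_sqrt_ext (K : finFieldType) (de : K) :
  exists (F : finFieldType) (f : {rmorphism K -> F}) (r : F), r ^+ 2 = f de.
Proof.
have nzp : 'X^2 - de%:P != 0 :> {poly K} by rewrite -size_poly_eq0 size_XnsubC.
have [L [rs prod_rs _]] := FinSplittingFieldFor nzp.
have def_p : map_poly (GRing.in_alg L) ('X^2 - de%:P) = 'X^2 - (GRing.in_alg L de)%:P.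
  by rewrite rmorphB /= map_polyXn map_polyC.
move: prod_rs; rewrite def_p => prod_rs.
case: rs prod_rs => [|r rs] prod_rs.
  by have := eqp_size prod_rs; rewrite big_nil size_XnsubC // size_poly1.
exists (FinFieldExtType L), (GRing.in_alg L), r.
have := eqp_root prod_rs r; rewrite big_cons rootM root_XsubC eqxx /= rootE !hornerE.
by rewrite subr_eq0 => /eqP.
Qed.

(** * Edges as unordered pairs *)

Lemma set2_eq (T : finType) (a b a' b' : T) : [set a; b] = [set a'; b'] ->
  (a = a' /\ b = b') \/ (a = b' /\ b = a').
Proof.
move=> E; have := set21 a b; have := set22 a b; rewrite E => /set2P eb /set2P ea.
have := set21 a' b'; have := set22 a' b'; rewrite -E => /set2P eb' /set2P ea'.
by case: ea ea' => ea [] ea'; case: eb eb' => eb [] eb'; subst; auto.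
Qed.

Section Edges.
Variables (F : finFieldType) (d : nat) (P : {set 'rV[F]_d}).

Lemma at_unit_distance_sym (a b : 'rV[F]_d) : at_unit_distance a b = at_unit_distance b a.
Proof.
rewrite /at_unit_distance !inE; congr (_ == 1); apply: eq_bigr => j _.
by rewrite -sqrrN opprB.
Qed.

Lemma edge_unit_distance (a b : 'rV[F]_d) :
  [set a; b] \in unit_distance_edges P -> at_unit_distance a b.
Proof.
case/imset2P=> a' b' _; rewrite inE => /andP[_ ab'] /set2_eq[] [-> ->] //.
by rewrite at_unit_distance_sym.
Qed.

Lemma card_arcs_le : (#|arcs (@at_unit_distance F d) P| <= 2 * #|unit_distance_edges P|)%N.
Proof.
pose f (p : 'rV[F]_d * 'rV[F]_d) := [set p.1; p.2].
rewrite -sum1_card (partition_big f (mem (unit_distance_edges P))) /=; last first.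
  move=> [a b]; rewrite inE /= => /and3P[Pa Pb ab].
  by apply/imset2P; exists a b; rewrite ?inE ?Pb.
rewrite mulnC -sum_nat_const; apply: leq_sum => E _; rewrite sum1_card.
have [p /andP[_ /eqP fp]|] :=
    pickP (fun p => (p \in arcs (@at_unit_distance F d) P) && (f p == E)).
  apply: (@leq_trans #|[set p; (p.2, p.1)]|); last by rewrite cards2; case: (_ != _).
  apply/subset_leq_card/subsetP=> -[a b]; rewrite unfold_in => /andP[_].
  rewrite -fp => /eqP/set2_eq[] /= [-> ->]; rewrite !inE ?eqxx ?orbT //.
  by case: (p) => ? ?; rewrite eqxx.
by move/eq_card0=> ->.
Qed.

End Edges.

(** * From the diagonal form to the sum of squares *)

Section Transfer.
Variables (K F : finFieldType) (d : nat) (f : {rmorphism K -> F}).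
Variables (g : 'I_d -> K) (r : 'I_d -> F).
Hypothesis r_sqr : forall j, r j ^+ 2 = f (g j).
Hypothesis g_nz : forall j, g j != 0.

(** As [r j] is a square root of [f (g j)], this is an isometry onto its image. *)
Definition rescale (v : 'rV[K]_d) : 'rV[F]_d := \row_j (r j * f (v 0 j)).

Lemma rescale_inj : injective rescale.
Proof.
move=> u v /rowP eq_uv; apply/rowP=> j; have := eq_uv j; rewrite !mxE => /mulfI E.
apply: (fmorph_inj f); apply: E.
by rewrite -sqrf_eq0 r_sqr fmorph_eq0.
Qed.

Lemma rescale_unit_distance a b :
  at_unit_distance (rescale a) (rescale b) = (qform g (b - a) == 1).
Proof.
rewrite /at_unit_distance inE -(inj_eq (fmorph_inj f)) rmorph1 rmorph_sum.
congr (_ == 1); apply: eq_bigr => j _.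
by rewrite !mxE -mulrBr exprMn r_sqr rmorphM rmorphXn rmorphB.
Qed.

Lemma card_arcs_rescale (P : {set 'rV[K]_d}) :
  (#|arcs (fun a b => qform g (b - a) == 1%R) P| <=
    #|arcs (@at_unit_distance F d) (rescale @: P)|)%N.
Proof.
have inj : injective (fun p => (rescale p.1, rescale p.2)).
  by move=> [a b] [a' b'] [/rescale_inj-> /rescale_inj->].
rewrite -(card_imset _ inj); apply: subset_leq_card; apply/subsetP=> p /imsetP[[a b]].
rewrite inE /= => /and3P[Pa Pb ab] ->.
by rewrite inE /= !imset_f //= rescale_unit_distance.
Qed.

Lemma preim_rescale (P : {set 'rV[K]_d}) (A : {set 'rV[F]_d}) :
  A \subset rescale @: P -> rescale @^-1: A \subset P /\ #|rescale @^-1: A| = #|A|.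
Proof.
move=> /subsetP AP; split.
  apply/subsetP=> v; rewrite inE => /AP/imsetP[u Pu].
  by move/rescale_inj->.
rewrite -(card_imset _ rescale_inj); apply: eq_card => v; apply/imsetP/idP.
  by case=> u; rewrite inE => Au ->.
by move=> Av; have /imsetP[u _ def_v] := AP v Av; exists u; rewrite ?inE -?def_v.
Qed.

Lemma rescale_biclique_free (P : {set 'rV[K]_d}) s :
    (forall A B : {set 'rV[K]_d}, A \subset P -> B \subset P ->
      (forall a b, a \in A -> b \in B -> qform g (b - a) = 1) ->
      (s < #|A|)%N -> (s < #|B|)%N -> False) ->
  ~ contains_complete_bipartite (rescale @: P) (unit_distance_edges (rescale @: P))
      s.+1 s.+1.
Proof.
move=> free [A [B [[AP BP _ cA cB] AB]]].
have [AP' cA'] := preim_rescale AP; have [BP' cB'] := preim_rescale BP.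
apply: (free _ _ AP' BP'); rewrite ?cA' ?cB' ?cA ?cB // => a b.
rewrite !inE => Aa Bb; apply/eqP.
by rewrite -rescale_unit_distance; apply: edge_unit_distance (AB _ _ Aa Bb).
Qed.

End Transfer.

(** * Choice of the field, the form and the constants *)

Lemma unit_distance_construction (d e n : nat) : (1 < d)%N -> (0 < e)%N ->
    (d <= 9 ^ e)%N -> (1 < n <= (9 ^ e) ^ (uphalf d).+1)%N ->
  exists (F : finFieldType) (P : {set 'rV[F]_d}), [/\ #|P| = n,
    ~ contains_complete_bipartite P (unit_distance_edges P)
        (2 * (2 * 9 ^ d) ^ d).+1 (2 * (2 * 9 ^ d) ^ d).+1
    & (n * n <= 32 * (9 ^ e * #|unit_distance_edges P|))%N].
Proof.
move=> d_gt1 e_gt0 d_le n_le.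
(* The even exponent makes [#|K|] equal to 1 modulo 4, so [-1] is a square. *)
have e2_gt0 : (0 < 2 * e)%N by rewrite muln_gt0.
have [K char3 cK] := pPrimePowerField (isT : prime 3) e2_gt0.
rewrite expnM in cK.
have nz2 : 2%:R != 0 :> K by rewrite -(dvdn_pcharf char3).
have [i i2] : exists i : K, i ^+ 2 = -1.
  apply: (@finField_sqrtN1 K (9 ^ e %/ 4)).
  by rewrite cK {1}(divn_eq (9 ^ e) 4) -modnXm exp1n mulnC addn1.
have [de nonsq] := finField_nonsquare nz2.
have nzde : de != 0 by apply: contraTneq (nonsq 0) => ->; rewrite expr0n eqxx.
have [F [f [r r2]]] := finField_sqrt_ext de.
pose m := (d./2).-1.
have half_gt0 : (0 < d./2)%N by rewrite half_gt0.
have dm : d./2 = m.+1 by rewrite prednK.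
have dD : (d - m = (uphalf d).+1)%N.
  by have := uphalf_half d; have := odd_double_half d; rewrite dm -addnn; lia.
(* For odd [d] the last coefficient is a nonsquare; all other coefficients are 1, in particular the
   first two. *)
pose last (j : 'I_d) := odd d && (j == d.-1 :> nat).
pose g (j : 'I_d) : K := if last j then de else 1.
pose rr (j : 'I_d) : F := if last j then r else 1.
have g_nz j : g j != 0 by rewrite /g; case: ifP; rewrite ?oner_eq0.
have rr_sqr j : rr j ^+ 2 = f (g j).
  by rewrite /rr /g; case: ifP; rewrite // expr1n rmorph1.
have prod_g : odd d -> \prod_j g j = de.
  have ltd : (d.-1 < d)%N by rewrite prednK // ltnW.
  move=> od; rewrite (bigD1 (Ordinal ltd)) //= big1 ?mulr1.
    by rewrite /g /last od eqxx.
  by move=> j; rewrite /g /last -val_eqE /= => /negPf->; rewrite andbF.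
have nonsquare : odd d -> forall e u : K, e ^+ 2 = 1 -> - \prod_j g j != e * u ^+ 2.
  (* Since [-1] is a square, neither [de] nor [-de] is a square. *)
  move=> od e0 u /eqP; rewrite sqrf_eq1 prod_g // => /orP[] /eqP->; apply/eqP => E.
    have := nonsq (i * u); rewrite exprMn i2 mulN1r.
    by rewrite -[de]opprK E mul1r eqxx.
  by have := nonsq u; rewrite -[de]opprK E mulN1r opprK eqxx.
have d_leK : (d <= #|K|)%N by rewrite cK.
pose al (j : 'I_d) : K := enum_val (widen_ord d_leK j).
have al_inj : injective al by move=> j j' /enum_val_inj/(congr1 val) /= /ord_inj.
have d_gt0 : (0 < d)%N := ltnW d_gt1.
have sphere_ge : (#|K| ^ d <= 2 * (#|[set v | qform g v == 1%R]| * #|K|))%N.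
  apply: (@card_unit_quadric K d g i (Ordinal d_gt0) (Ordinal d_gt1)) => //.
    by rewrite /g /last /=; case: ifP => // /andP[_ /eqP ?]; exfalso; lia.
  rewrite /g /last /=; case: ifP => // /andP[od /eqP d1].
  by have d2 : d = 2 by [lia]; rewrite d2 in od.
rewrite -dD -[X in (_ <= X ^ _)%N]cK in n_le.
have [P [cP free le]] := dense_biclique_free char3 al_inj dm g_nz nonsquare sphere_ge n_le.
exists F, (rescale f rr @: P); split.
- by rewrite card_imset //; apply: rescale_inj rr_sqr g_nz.
- exact: (rescale_biclique_free rr_sqr g_nz free).
apply: leq_trans le _; rewrite cK (_ : 32 = 16 * 2)%N // -mulnA leq_mul2l /= mulnCA leq_mul2l.
apply/orP; right; apply: leq_trans (card_arcs_rescale rr_sqr g_nz P) (card_arcs_le _).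
Qed.

Theorem theorem1p5 (R : realType) (d : nat) (hd : (1 < d)%N) :
  exists (s : nat) (c : R), 0 < c /\
    forall n : nat, (1 < n)%N ->
      exists (F : finFieldType) (P : {set 'rV[F]_d}),
        [/\ #|P| = n,
            ~ contains_complete_bipartite P (unit_distance_edges P) s s
          & c * n%:R `^ (2 - (uphalf d).+1%:R^-1)
              <= #|unit_distance_edges P|%:R].
Proof.
(* Here [288 = 32 * 9]: the 9 is the ratio of consecutive field sizes, and [d] pays for requiring
   [d <= 9 ^ e]. *)
set D := (uphalf d).+1; pose c : R := (288 * d)%:R^-1.
have d_gt0 : (0 < d)%N := ltnW hd.
have c_gt0 : 0 < c by rewrite invr_gt0 ltr0n muln_gt0.
exists (2 * (2 * 9 ^ d) ^ d).+1, c; split=> // n n_gt1.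
(* The field needs [d] distinct elements [al j], and its fibers need at least [n] points. *)
pose Pe e := (d <= 9 ^ e)%N && (n <= (9 ^ e) ^ D)%N.
have exPe : exists e, Pe e.
  exists (d + n)%N; have lt9 k : (k <= 9 ^ k)%N by rewrite ltnW // ltn_expl.
  apply/andP; split; first exact: leq_trans (leq_addr n d) (lt9 _).
  apply: leq_trans (leq_trans (leq_addl d n) (lt9 _)) _.
  by rewrite -{1}[(9 ^ _)%N]expn1 leq_pexp2l // expn_gt0.
have [e /andP[d_le n_le] min_e] := ex_minnP exPe.
have e_gt0 : (0 < e)%N.
  by rewrite lt0n; apply: contraTneq n_le => ->; rewrite expn0 exp1n -ltnNge.
have [|F [P [cP free le_nn]]] := unit_distance_construction hd e_gt0 d_le (n := n).
  by rewrite n_gt1.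
exists F, P; split=> //.
set E := #|_|; set rho : R := n%:R `^ D%:R^-1.
have n_gt0 : 0 < n%:R :> R by rewrite ltr0n ltnW.
have rho_gt0 : 0 < rho by apply: powR_gt0.
have rhoD : rho ^+ D = n%:R.
  by rewrite -powR_mulrn ?ltW // -powRrM mulVf ?pnatr_eq0 // powRr1 // ltW.
(* By minimality of [e], the number [9 ^ (e - 1)] is below [d] or below [rho], hence at most
   [d * rho]. *)
have q_le : (9 ^ e)%:R <= 9 * d%:R * rho.
  have lt_rho k : (k ^ D < n)%N -> k%:R < rho.
    move=> lt_kn; rewrite -(@ltr_pXn2r _ D) ?nnegrE ?ler0n ?(ltW rho_gt0) //.
    by rewrite rhoD -natrX ltr_nat.
  have ge1 : 1 < rho by apply: (lt_rho 1%N); rewrite exp1n.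
  have d_ge1 : 1 <= d%:R :> R by rewrite ler1n.
  have: ~~ Pe e.-1 by apply/negP=> /min_e; rewrite -ltnS prednK // ltnn.
  rewrite -{2}(prednK e_gt0) expnS natrM -mulrA ler_pM2l ?ltr0n // negb_and -!ltnNge.
  case/orP=> [lt_d|/lt_rho/ltW le_rho].
    apply: le_trans (_ : d%:R <= _); first by rewrite ler_nat ltnW.
    by rewrite ler_peMr // ltW.
  by apply: le_trans le_rho _; rewrite ler_peMl // ltW.
have -> : n%:R `^ (2 - D%:R^-1) = n%:R * n%:R / rho.
  rewrite powRB; last by apply/implyP => _; rewrite gt_eqF.
  by rewrite powR_mulrn ?expr2 // ltW.
rewrite mulrA ler_pdivrMr // /c mulrC ler_pdivrMr ?ltr0n ?muln_gt0 //.
have : (n%:R * n%:R : R) <= 32 * ((9 ^ e)%:R * E%:R) by rewrite -!natrM ler_nat.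
move/le_trans; apply; rewrite natrM.
have : (9 ^ e)%:R * E%:R <= 9 * d%:R * rho * E%:R :> R by rewrite ler_wpM2r ?ler0n.
rewrite -(ler_pM2l (_ : 0 < 32)) ?ltr0n // => /le_trans; apply.
by rewrite le_eqVlt; apply/orP; left; apply/eqP; ring.
Qed.
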